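(* Let $A\in\mathbb{C}^{n\times n}$ and let $\{u_k\}$ be a sequence of unit vectors generated by the MSJD method applied to $A$, where $u_k$ denotes the approximation, at the $k$th iteration, to an eigenvector $x$ corresponding to an eigenvalue $\lambda$ of $A$. Let $\rho_k := u_k^\ast A u_k$ be the Rayleigh quotient of $u_k$ with respect to $A$. Then the sequences $\{\|(A-\rho_k I)u_k\|^2\}$ and $\{\|(A-\rho_k I)u_{k+1}\|^2\}$ converge to the same limit. Further, $|\rho_{k+1}-\rho_k|\to 0$ as $k\to\infty$.
   Context: $\|\cdot\|$ is the Euclidean norm and $^\ast$ the conjugate transpose. The Modified Simplified Jacobi-Davidson (MSJD) method for a matrix $A$ starts from a unit vector and, given the current unit vector $u_k$ with Rayleigh quotient $\rho_k=u_k^\ast A u_k$, computes $u_{k+1}$ as follows. Step 1: find a vector $t_k$ that minimizes, over all vectors $t$, the quantity $\|(A-\rho_k I)u_k+(A-\rho_k I)(I-u_ku_k^\ast)t\|^2$. Step 2: set $u_{k+1}=\dfrac{u_k+(I-u_ku_k^\ast)t_k}{\|u_k+(I-u_ku_k^\ast)t_k\|}$. *)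

(* Defs.v *)
From mathcomp Require Export all_boot all_order all_algebra.
From mathcomp Require Export all_classical all_reals all_analysis.
From mathcomp.real_closed Require Export complex.
Export Order.TTheory GRing.Theory Num.Theory.
Export numFieldNormedType.Exports.

Set Implicit Arguments.
Unset Strict Implicit.
Unset Printing Implicit Defensive.

Local Open Scope ring_scope.
Local Open Scope complex_scope.
Local Open Scope sesquilinear_scope.

Section MSJD.
Variables (R : realType) (n : nat).
Implicit Types (A : 'M[R[i]]_n) (u v t : 'cV[R[i]]_n).

(* [ComplexField.Normc.normc] is the modulus with values in [R]; the norm
   [`|_|] of [R[i]] takes its values in [R[i]]. *)
Definition enorm v : R :=
  Num.sqrt (\sum_(i < n) ComplexField.Normc.normc (v i 0) ^+ 2).

Definition rayleigh A u : R[i] := (u ^t* *m A *m u) 0 0.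

Definition shifted A u : 'M[R[i]]_n := A - (rayleigh A u)%:M.

(* For a unit vector [u], the orthogonal projector onto its complement. *)
Definition projc u : 'M[R[i]]_n := 1%:M - u *m u ^t*.

Definition msjd_objective A u t : R :=
  enorm (shifted A u *m u + shifted A u *m projc u *m t) ^+ 2.

(* The minimizer need not be unique, so a step is a relation rather than a
   function: any minimizer [t] may be chosen. *)
Definition msjd_step A u u' : Prop :=
  exists t : 'cV[R[i]]_n,
    (forall s : 'cV[R[i]]_n, msjd_objective A u t <= msjd_objective A u s) /\
    u' = ((enorm (u + projc u *m t))^-1)%:C *: (u + projc u *m t).

Definition msjd_sequence A (u : nat -> 'cV[R[i]]_n) : Prop :=
  enorm (u 0%N) = 1 /\ forall k, msjd_step A (u k) (u k.+1).

End MSJD.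

(* Main.v *)
Require Import Defs.

(** A Rayleigh quotient minimizes the residual over all shifts:
    [|(A - m I) v|^2 = |(A - rho(v) I) v|^2 + |rho(v) - m|^2] for unit [v].
    Set [a_k = |(A - rho_k I) u_k|^2] and [b_k = |(A - rho_k I) u_{k+1}|^2].
    Comparing the minimizer of Step 1 with [t = 0], and noting that the vector
    normalized in Step 2 has norm at least 1, gives [b_k <= a_k]; the identity
    with [v = u_{k+1}] and [m = rho_k] gives
    [a_{k+1} + |rho_{k+1} - rho_k|^2 = b_k].  So [a] is nonincreasing and
    nonnegative, hence convergent, [b] is squeezed between two shifts of [a],
    and the squared increments of [rho] tend to 0. *)

Set Implicit Arguments.
Unset Strict Implicit.
Unset Printing Implicit Defensive.

Local Open Scope ring_scope.
Local Open Scope classical_set_scope.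
Local Open Scope complex_scope.
Local Open Scope sesquilinear_scope.

Section EuclideanNorm.
Variables (R : realType) (n : nat).
Implicit Types (A : 'M[R[i]]_n) (v x y t : 'cV[R[i]]_n).

Local Notation normc := (@ComplexField.Normc.normc R).

Lemma normc_ge0 (z : R[i]) : 0 <= normc z.
Proof. by case: z => a b; rewrite /= sqrtr_ge0. Qed.

Lemma normc_sqrE (z : R[i]) : (normc z ^+ 2)%:C = z^* * z.
Proof. by rewrite mulrC -sqr_normc rmorphXn. Qed.

Lemma normc_realV (r : R) : 0 < r -> normc (r^-1)%:C = r^-1.
Proof.
by move=> r0; rewrite /= expr0n addr0 sqrtr_sqr gtr0_norm// invr_gt0.
Qed.

Lemma enorm_ge0 v : 0 <= enorm v.
Proof. exact: sqrtr_ge0. Qed.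

Lemma sqr_enorm v : enorm v ^+ 2 = \sum_(i < n) normc (v i 0) ^+ 2.
Proof. by rewrite sqr_sqrtr// sumr_ge0// => i _; exact: sqr_ge0. Qed.

(** Bridge from the real-valued norm to matrix algebra: orthogonality arguments run in [R[i]] on
    [v ^t* *m v]. *)
Lemma enorm_sqrE v : (enorm v ^+ 2)%:C = (v ^t* *m v) 0 0.
Proof.
rewrite sqr_enorm rmorph_sum mxE; apply: eq_bigr => i _.
by rewrite !mxE -normc_sqrE.
Qed.

Lemma enorm1_mulmx v : enorm v = 1 -> v ^t* *m v = 1%:M.
Proof. by move=> v1; rewrite [LHS]mx11_scalar -enorm_sqrE v1 expr1n. Qed.

Lemma sqr_enormZ (c : R[i]) v :
  enorm (c *: v) ^+ 2 = normc c ^+ 2 * enorm v ^+ 2.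
Proof.
rewrite !sqr_enorm mulr_sumr; apply: eq_bigr => i _.
by rewrite mxE ComplexField.Normc.normcM exprMn.
Qed.

Lemma sqr_enormD x y :
  x ^t* *m y = 0 -> enorm (x + y) ^+ 2 = enorm x ^+ 2 + enorm y ^+ 2.
Proof.
(* The second cross term is the adjoint of the first. *)
move=> xy0; have yx0 : y ^t* *m x = 0.
  by rewrite -[x]trmxCK -map_mxM -trmx_mul xy0 trmx0 map_mx0.
apply: complexI; rewrite rmorphD /= !enorm_sqrE [_^T]linearD map_mxD mulmxDl !mulmxDr.
by rewrite xy0 yx0 addr0 add0r mxE.
Qed.

(** Pythagoras: the residual [shifted A v *m v] is orthogonal to [v], since [v] is a unit vector. *)
Lemma sqr_enorm_shift A v (m : R[i]) : enorm v = 1 ->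
  enorm ((A - m%:M) *m v) ^+ 2 =
  enorm (shifted A v *m v) ^+ 2 + normc (rayleigh A v - m) ^+ 2.
Proof.
move=> v1; have vv := enorm1_mulmx v1.
have -> : (A - m%:M) *m v = (rayleigh A v - m) *: v + shifted A v *m v.
  by rewrite !mulmxBl !mul_scalar_mx scalerBl [RHS]addrC addrA subrK.
rewrite sqr_enormD ?sqr_enormZ ?v1 ?expr1n ?mulr1 1?addrC//.
rewrite [_^T]linearZ map_mxZ -scalemxAl mulmxBl mul_scalar_mx mulmxBr -scalemxAr vv.
by rewrite mulmxA [_ *m A *m v]mx11_scalar scalemx1 subrr scaler0.
Qed.

(** The correction [projc v *m t] is orthogonal to [v], so adding it cannot shorten [v]. *)
Lemma enorm_projc_ge1 v t : enorm v = 1 -> 1 <= enorm (v + projc v *m t).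
Proof.
move=> v1; rewrite -(@ler_sqr _ 1) ?nnegrE ?enorm_ge0// expr1n.
rewrite sqr_enormD ?v1 ?expr1n ?lerDl ?sqr_ge0//.
by rewrite mulmxA mulmxBr mulmx1 mulmxA enorm1_mulmx// mul1mx subrr mul0mx.
Qed.

Lemma msjd_step_enorm A u u' : enorm u = 1 -> msjd_step A u u' -> enorm u' = 1.
Proof.
move=> u1 [t [_ ->]]; have w1 := enorm_projc_ge1 t u1.
set w := u + _ in w1 *.
(* Step 2 thus never divides by zero, where the inverse would default to 0. *)
have w0 : 0 < enorm w by exact: lt_le_trans w1.
apply/eqP; rewrite -sqrp_eq1 ?enorm_ge0// sqr_enormZ -exprMn.
by rewrite normc_realV// mulVf ?(gt_eqF w0)// expr1n.
Qed.

Lemma msjd_step_shifted_le A u u' : enorm u = 1 -> msjd_step A u u' ->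
  enorm (shifted A u *m u') ^+ 2 <= enorm (shifted A u *m u) ^+ 2.
Proof.
move=> u1 [t [/(_ 0) tmin ->]]; have w1 := enorm_projc_ge1 t u1.
(* By linearity the objective at [t] is the squared norm of [shifted A u] applied to the
   unnormalized iterate. *)
rewrite /msjd_objective mulmx0 addr0 -mulmxA -mulmxDr in tmin.
set w := u + _ in w1 tmin *.
have w0 : 0 < enorm w by exact: lt_le_trans w1.
apply: le_trans tmin; rewrite -scalemxAr sqr_enormZ ler_piMl ?sqr_ge0//.
by rewrite normc_realV// expr_le1 ?invr_ge0 ?enorm_ge0// invf_le1.
Qed.

End EuclideanNorm.

Lemma nonincreasing_interlace_cvg (R : realType) (a b : R ^nat) :
  (forall k, 0 <= a k) -> (forall k, b k <= a k) ->
  (forall k, a k.+1 <= b k) ->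
  (exists l : R, a @ \oo --> l /\ b @ \oo --> l) /\
  (fun k => b k - a k.+1) @ \oo --> (0 : R).
Proof.
move=> a0 ba ab.
have acvg : cvgn a.
  apply: nonincreasing_is_cvgn.
    by apply/nonincreasing_seqP => k; exact: le_trans (ba k).
  by exists 0 => _ [k _ <-].
have aScvg : (fun k => a k.+1) @ \oo --> limn a by rewrite (cvg_shiftS a).
have bcvg : b @ \oo --> limn a.
  apply: (@squeeze_cvgr _ _ _ _ (fun k => a k.+1) a) => //.
  by apply: nearW => k; rewrite ab ba.
split; first by exists (limn a).
by rewrite -[X in _ --> X](subrr (limn a)); exact: cvgB.
Qed.

Theorem theorem3p1 (R : realType) (n : nat) (A : 'M[R[i]]_n)
    (u : nat -> 'cV[R[i]]_n) (hu : msjd_sequence A u) :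
  (exists l : R,
     (fun k => enorm ((A - (rayleigh A (u k))%:M) *m u k) ^+ 2) @ \oo --> l /\
     (fun k => enorm ((A - (rayleigh A (u k))%:M) *m u k.+1) ^+ 2) @ \oo --> l) /\
  (fun k => ComplexField.Normc.normc (rayleigh A (u k.+1) - rayleigh A (u k)))
    @ \oo --> (0 : R).
Proof.
case: hu => u0 ustep.
have u1 k : enorm (u k) = 1.
  by elim: k => // k uk; exact: msjd_step_enorm (ustep k).
pose a k := enorm (shifted A (u k) *m u k) ^+ 2.
pose b k := enorm (shifted A (u k) *m u k.+1) ^+ 2.
pose d k := ComplexField.Normc.normc (rayleigh A (u k.+1) - rayleigh A (u k)).
have bE k : b k = a k.+1 + d k ^+ 2 by exact: sqr_enorm_shift.
have [||k|abl ba0] := @nonincreasing_interlace_cvg R a b.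
- by move=> k; exact: sqr_ge0.
- by move=> k; exact: msjd_step_shifted_le.
- by rewrite bE lerDl sqr_ge0.
split; first exact: abl.
(* Only [d k ^+ 2] is known to vanish; continuity of the square root at 0 passes this to [d]. *)
have dE : d = fun k => Num.sqrt (b k - a k.+1).
  by apply/funext => k; rewrite bE addrC addKr sqrtr_sqr ger0_norm ?normc_ge0.
rewrite -/d dE -[X in _ --> X]sqrtr0.
by apply: continuous_cvg; [exact: sqrt_continuous | exact: ba0].
Qed.
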